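(* Let $d\ge 1$, $n\ge1$, and let $J=(j_1,\dots,j_{2n})$ be a list with entries in $\{1,\dots,d\}$ whose multiplicity partition $\mu=(\mu_1,\dots,\mu_\ell)$ has all parts even. Then $$\int_{O(d)} g_{1j_1}g_{1j_2}\cdots g_{1j_{2n}}\,dO=\Big(\prod_{i=1}^{\ell}(\mu_i-1)!!\Big)\sum_{\lambda\vdash n}C(\lambda)\,W^O(\lambda),$$ where $dO$ is the normalized Haar measure on the orthogonal group $O(d)$.
   Context: The multiplicity partition of a list is the partition formed by the numbers of occurrences of its distinct entries, arranged in decreasing order. For $\lambda\vdash n$, $C(\lambda)$ is the number of pair partitions of $\{1,\dots,2n\}$ (set partitions into $n$ blocks of size 2) of coset-type $\lambda$, where the coset-type of a pair partition $\sigma$ is defined as follows: form the multigraph on $\{1,\dots,2n\}$ with edges $\{2k-1,2k\}$ ($k=1,\dots,n$) together with the blocks of $\sigma$; each connected component has $2k$ vertices for some $k$, and the coset-type is the partition of $n$ formed by these numbers $k$. The same definition applies to permutations $\sigma\in S_{2n}$ using the edges $\{\sigma(2k-1),\sigma(2k)\}$. Let $H_n\subset S_{2n}$ be the hyperoctahedral group (centralizer of $(1\,2)(3\,4)\cdots(2n-1\,2n)$). The orthogonal Weingarten function is $$W^O(\sigma)=\frac{2^nn!}{(2n)!}\sum_{\lambda\vdash n,\ \ell(\lambda)\le d}\frac{\chi_{2\lambda}(1)}{J^{(2)}_\lambda(1)}\,\omega_\lambda(\sigma),\qquad \omega_\lambda(\sigma)=\frac{1}{2^nn!}\sum_{h\in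 H_n}\chi_{2\lambda}(\sigma h),$$ for $\sigma\in S_{2n}$, where $\chi_{2\lambda}$ is the irreducible character of $S_{2n}$ indexed by $2\lambda=(2\lambda_1,2\lambda_2,\dots)$ and $J^{(2)}_\lambda(1)$ is the Jack polynomial with parameter $\alpha=2$ in $d$ variables evaluated at $(1,\dots,1)$, i.e. $\prod_{(i,j)\in\lambda}(d-(i-1)+2(j-1))$. $W^O(\sigma)$ depends only on the coset-type of $\sigma$, and $W^O(\lambda)$ denotes its value on permutations of coset-type $\lambda$. For odd $m\ge1$, $m!!=m(m-2)\cdots 3\cdot 1$. *)

(* Defs.v *)
From HB Require Import structures.
From mathcomp Require Import all_boot all_order all_algebra all_fingroup.
From mathcomp Require Import mxrepresentation.
From mathcomp Require Import all_classical all_reals all_analysis.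

Set Implicit Arguments.
Unset Strict Implicit.
Unset Printing Implicit Defensive.
Import Order.TTheory GRing.Theory Num.Theory.
Import numFieldNormedType.Exports.

Local Open Scope classical_set_scope.
Local Open Scope ring_scope.

Fixpoint double_fact (m : nat) : nat :=
  if m is k.+2 then (k.+2 * double_fact k)%N else 1%N.

Definition is_part (n : nat) (s : seq nat) : bool :=
  [&& sorted geq s, 0%N \notin s & sumn s == n].

Record intpart (n : nat) := IntPart {
  parts :> seq nat;
  partsP : is_part n parts }.

HB.instance Definition _ (n : nat) := [isSub for @parts n].
HB.instance Definition _ (n : nat) := [Countable of intpart n by <:].

Lemma size_sumn (s : seq nat) : 0%N \notin s -> (size s <= sumn s)%N.
Proof.
elim: s => //= a s IHs; rewrite inE negb_or => /andP[a0 /IHs le_s].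
by rewrite -add1n leq_add // lt0n eq_sym.
Qed.

Definition intpart_bseq (n : nat) (la : intpart n) : n.-bseq 'I_n.+1 :=
  insub_bseq n [seq inord i | i <- la].

Definition bseq_intpart (n : nat) (b : n.-bseq 'I_n.+1) : option (intpart n) :=
  insub [seq val i | i <- b].

Lemma intpart_bseqK (n : nat) : pcancel (@intpart_bseq n) (@bseq_intpart n).
Proof.
case=> s Hs; case/and3P: (Hs) => _ s0 /eqP sn.
rewrite /bseq_intpart /intpart_bseq /insub_bseq /= insubdK; last first.
  by rewrite unfold_in /= size_map -[X in (_ <= X)%N]sn size_sumn.
suff -> : [seq val i | i <- [seq (inord i : 'I_n.+1) | i <- s]] = s :> seq nat.
  by rewrite insubT.
rewrite -map_comp map_id_in // => i si /=; rewrite inordK // ltnS -sn.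
elim: s si {Hs s0 sn} => //= a s IHs; rewrite inE => /orP[/eqP ->|/IHs le_is].
  exact: leq_addr.
exact: leq_trans (leq_addl _ _).
Qed.

HB.instance Definition _ (n : nat) :=
  fintype.isFinite.Build (intpart n) (pcan_enumP (@intpart_bseqK n)).

Definition mult_partition (T : eqType) (s : seq T) : seq nat :=
  sort geq [seq count_mem x s | x <- undup s].

(* The points 1, ..., 2n are encoded as the elements of 'I_n.*2, so that the
   pairs {2k-1, 2k}, 1 <= k <= n, are the pairs {lo k, hi k}, k : 'I_n. *)

Lemma lo_subproof (n : nat) (k : 'I_n) : (k.*2 < n.*2)%N.
Proof. by rewrite ltn_double. Qed.

Lemma hi_subproof (n : nat) (k : 'I_n) : (k.*2.+1 < n.*2)%N.
Proof. by rewrite ltn_Sdouble. Qed.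

Definition lo (n : nat) (k : 'I_n) : 'I_n.*2 := Ordinal (lo_subproof k).
Definition hi (n : nat) (k : 'I_n) : 'I_n.*2 := Ordinal (hi_subproof k).

Definition pairs_of (n : nat) (s : 'S_n.*2) : {set {set 'I_n.*2}} :=
  [set [set s (lo k); s (hi k)]%SET | k : 'I_n]%SET.

Definition pair_partition (n : nat) (P : {set {set 'I_n.*2}}) : bool :=
  finset.partition P [set: 'I_n.*2]%SET &&
  [forall B : {set 'I_n.*2}, (B \in P) ==> (#|B| == 2%N)].

Definition pair_graph (n : nat) (P : {set {set 'I_n.*2}}) : rel 'I_n.*2 :=
  fun x y => [set x; y]%SET \in (pairs_of (1%g : 'S_n.*2) :|: P)%SET.

Definition coset_type_of (n : nat) (P : {set {set 'I_n.*2}}) : seq nat :=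
  sort geq [seq #|B|./2 |
    B : {set 'I_n.*2} <- enum [set [set y | connect (pair_graph P) x y]%SET
              | x : 'I_n.*2]%SET].

Definition coset_type (n : nat) (s : 'S_n.*2) : seq nat :=
  coset_type_of (pairs_of s).

Definition num_coset_type (n : nat) (la : intpart n) : nat :=
  #|[set P : {set {set 'I_n.*2}} |
      pair_partition P && (coset_type_of P == la)]%SET|.

(* Row and column stabilizers of the tableau of shape [la] filled row by row
   with 0, ..., m-1: k lies in row [reshape_index la k] and in column
   [reshape_offset la k]. *)

Definition row_stab (m : nat) (la : seq nat) : {set 'S_m} :=
  [set s : 'S_m | [forall k : 'I_m,
     reshape_index la (s k) == reshape_index la k]]%SET.

Definition col_stab (m : nat) (la : seq nat) : {set 'S_m} :=
  [set s : 'S_m | [forall k : 'I_m,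
     reshape_offset la (s k) == reshape_offset la k]]%SET.

(* The Young symmetrizer, as an element of the group algebra F[S_m].  The
   product of permutations is (q * p) x = p (q x), so [q * p] is the composite
   usually written pq. *)
Definition young_symmetrizer (F : fieldType) (m : nat) (la : seq nat) :
    'rV[F]_(gcard [set: 'S_m]%G) :=
  \sum_(p in row_stab m la) \sum_(q in col_stab m la)
    (-1) ^+ (odd_perm q) *: delta_mx 0 (gring_index [set: 'S_m]%G (q * p)%g).

(* The ideal of F[S_m] generated by the Young symmetrizer: for F of
   characteristic 0 and [la] a partition of m, this is the irreducible
   representation of S_m indexed by [la].  With the above product, the usual
   left ideal is a right ideal and carries the right regular action. *)
Definition specht_repr (F : fieldType) (m : nat) (la : seq nat) :=
  submod_repr (cyclic_mx_module (regular_repr F [set: 'S_m]%G)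
                                (young_symmetrizer F m la)).

Definition sym_char (F : fieldType) (m : nat) (la : seq nat) (s : 'S_m) : F :=
  \tr (specht_repr F m la s).

Definition hyperoctahedral (n : nat) : {group 'S_n.*2} :=
  'C[(\prod_(k < n) tperm (lo k) (hi k))%g]%G.

Definition double_part (la : seq nat) : seq nat := [seq k.*2 | k <- la].

Definition zonal_spherical (F : fieldType) (n : nat) (la : intpart n)
    (s : 'S_n.*2) : F :=
  ((2 ^ n * n`!)%:R)^-1 *
    \sum_(h in hyperoctahedral n) sym_char F (double_part la) (s * h)%g.

(* J^(2)_la(1, ..., 1) in d variables; i and j count from 0. *)
Definition jack2_one (F : fieldType) (d : nat) (la : seq nat) : F :=
  \prod_(i < size la) \prod_(j < nth 0%N la i)
    (d%:R - i%:R + 2 * j%:R).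

Definition weingarten (F : fieldType) (d n : nat) (s : 'S_n.*2) : F :=
  (2 ^ n * n`!)%:R / ((2 * n)`!)%:R *
    \sum_(la : intpart n | (size la <= d)%N)
      sym_char F (double_part la) (1%g : 'S_n.*2) / jack2_one F d la *
      zonal_spherical F la s.

(* The value on the permutations of coset-type [la]; every partition of n is
   the coset-type of some permutation, so the default value is not used. *)
Definition weingarten_part (F : fieldType) (d n : nat) (la : intpart n) : F :=
  if [pick s : 'S_n.*2 | coset_type s == la] is Some s
  then weingarten F d s else 0.

Definition is_orthogonal (R : realType) (d : nat) : pred 'M[R]_d :=
  fun M => M *m M^T == 1%:M.

Record orthogonal_group (R : realType) (d : nat) := Orthogonal {
  omx :> 'M[R]_d;
  omxP : is_orthogonal omx }.

HB.instance Definition _ (R : realType) (d : nat) := [isSub for @omx R d].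
HB.instance Definition _ (R : realType) (d : nat) :=
  [Choice of orthogonal_group R d by <:].

Lemma is_orthogonal1 (R : realType) (d : nat) : is_orthogonal (1%:M : 'M[R]_d).
Proof. by rewrite /is_orthogonal trmx1 mulmx1. Qed.

Lemma is_orthogonalM (R : realType) (d : nat) (g h : orthogonal_group R d) :
  is_orthogonal (g *m h).
Proof.
rewrite /is_orthogonal trmx_mul mulmxA -(mulmxA (omx g)) (eqP (omxP h)).
by rewrite mulmx1; exact: omxP.
Qed.

Definition orthogonal1 (R : realType) (d : nat) : orthogonal_group R d :=
  Orthogonal (is_orthogonal1 R d).

Definition orthogonal_mul (R : realType) (d : nat) (g h : orthogonal_group R d) :
  orthogonal_group R d := Orthogonal (is_orthogonalM g h).

HB.instance Definition _ (R : realType) (d : nat) :=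
  isPointed.Build (orthogonal_group R d) (orthogonal1 R d).
HB.instance Definition _ (R : realType) (d : nat) :=
  Topological.copy (orthogonal_group R d) (initial_topology (@omx R d)).

Definition borel_orthogonal (R : realType) (d : nat) :=
  g_sigma_algebraType (@open (orthogonal_group R d)).

(* Left-invariant Borel probability measures: since O(d) is compact, this
   determines the normalized Haar measure, which is also right-invariant. *)
Definition is_haar (R : realType) (d : nat)
    (mu : probability (borel_orthogonal R d) R) : Prop :=
  forall (g : orthogonal_group R d) (A : set (borel_orthogonal R d)),
    measurable A -> mu (orthogonal_mul g @` A) = mu A.

(* Main.v *)
Require Import Defs.
From mathcomp Require Import all_boot all_order all_algebra all_fingroup.
From mathcomp Require Import mxrepresentation ring.
From mathcomp Require Import all_classical all_reals all_analysis.
From mathcomp Require Import measurable_realfun.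

(**
  Both sides equal (prod_i (mu_i - 1)!!) / (d (d + 2) ... (d + 2n - 2)).

  Right-hand side.  Permutations with the same coset-type lie in the same
  double coset of H = H_n and W^O is H-biinvariant, so the sum over la is
  |H|^-1 times the sum of W^O over S_2n.  The character of 2la sums to zero
  over S_2n unless la = (n), where it is the trivial character; only
  1 / J_(n)(1) remains.

  Left-hand side.  Left invariance shows that the matrix P of mixed moments of
  degree 2n satisfies P = P^T P, so P is symmetric and the first row may be
  replaced by the first column x of g, a vector of norm 1 whose moments are
  rotation invariant.  Differentiating the invariance under rotations of the
  coordinate planes and summing over the planes containing the j-th axis gives
  (d - 1 + deg f) E[x_j f] = E[d f / d x_j] for every monomial f.
*)

Set Implicit Arguments.
Unset Strict Implicit.
Unset Printing Implicit Defensive.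
Import Order.TTheory GRing.Theory Num.Theory.
Import numFieldNormedType.Exports.

Local Open Scope ring_scope.

(** * Characters of the symmetric group *)

Section SymmetricCharacters.
Variables (F : numFieldType) (m : nat).
Local Notation G := [set: 'S_m]%G.
Local Notation aG := (regular_repr F G).

Let e (x : 'S_m) : 'rV[F]_(gcard G) := delta_mx 0 (gring_index G x).

Lemma regular_repr_delta (x g : 'S_m) : e x *m aG g = e (x * g)%g.
Proof. by rewrite -rowE rowK gring_indexK ?in_setT. Qed.

Lemma regular_repr_delta_sum (x : 'S_m) :
  e x *m (\sum_(g : 'S_m) aG g) = \sum_(g : 'S_m) e g.
Proof.
rewrite mulmx_sumr [RHS](reindex_inj (mulgI x)) /=.
by apply: eq_bigr => g _; rewrite regular_repr_delta.
Qed.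

Lemma sym_charC (la : seq nat) (s t : 'S_m) :
  sym_char F la (s * t)%g = sym_char F la (t * s)%g.
Proof. by rewrite /sym_char !repr_mxM ?in_setT // mxtrace_mulC. Qed.

(* Right multiplication by the sum N of all permutations kills the Young
   symmetrizer, as the signs in the column stabilizer cancel; hence it kills
   the whole cyclic module. *)
Lemma sum_sym_char_eq0 (la : seq nat) (t : 'S_m) :
  (t : bool) -> t \in col_stab m la ->
  \sum_(s : 'S_m) sym_char F la s = 0.
Proof.
move=> odd_t tC; set u := young_symmetrizer F m la.
pose N := \sum_(g : 'S_m) aG g.
have uN0 : u *m N = 0.
  rewrite /u /young_symmetrizer mulmx_suml big1 // => p _.
  rewrite mulmx_suml.
  under eq_bigr do rewrite -scalemxAl regular_repr_delta_sum.
  rewrite -scaler_suml; set S := \sum_(q in _) _.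
  have tcol q : ((t * q)%g \in col_stab m la) = (q \in col_stab m la).
    move: tC; rewrite !inE => /forallP tC.
    apply/forallP/forallP => qC k; last first.
      by rewrite permM (eqP (qC _)).
    have := qC ((t^-1)%g k); rewrite permM permKV => /eqP ->.
    by rewrite -{2}(permKV t k) eq_sym.
  have SN : S = - S.
    rewrite {1}/S (reindex_inj (mulgI t)) /=.
    under eq_bigl do rewrite tcol.
    rewrite -sumrN; apply: eq_bigr => q _.
    by rewrite odd_permM odd_t /= signrN.
  suff -> : S = 0 by rewrite scale0r.
  have : S *+ 2 == 0 by rewrite mulr2n {2}SN subrr.
  by rewrite mulrn_eq0 /= => /eqP.
have NG g : aG g *m N = N *m aG g.
  rewrite mulmx_suml mulmx_sumr (reindex_inj (mulIg g)) /=.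
  rewrite [LHS](reindex_inj (mulgI (g^-1)%g)) /=.
  by apply: eq_bigr => h _; rewrite -!repr_mxM ?in_setT // mulgA mulKVg.
have UN0 : (cyclic_mx aG u <= kermx N)%MS.
  apply: cyclic_mx_sub; last by apply/sub_kermxP.
  apply/mxmoduleP => g _; apply/sub_kermxP.
  by rewrite -mulmxA NG mulmxA mulmx_ker mul0mx.
rewrite /sym_char -raddf_sum /=.
(* The rows of [W] are a basis of the cyclic module, so the sum of characters is the trace of [N]
   written in that basis. *)
pose W := val_submod (1%:M : 'M[F]_(\rank (cyclic_mx aG u))).
have WN0 : W *m N = 0.
  by apply/sub_kermxP; apply: submx_trans UN0; rewrite val_submod1.
rewrite [X in \tr X](_ : _ = in_submod (cyclic_mx aG u) (W *m N)).
  by rewrite WN0 in_submodE mul0mx mxtrace0.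
rewrite in_submodE /N mulmx_sumr mulmx_suml; apply: eq_bigr => g _.
by rewrite -in_submodE.
Qed.

(** For a single row the column stabilizer is trivial and the row stabilizer is everything. The
    Young symmetrizer is then the sum of all permutations, which spans a line fixed pointwise by the
    action. *)
Lemma sym_char_trivial (s : 'S_m) : sym_char F [:: m] s = 1.
Proof.
set u := young_symmetrizer F m [:: m].
have uE : u = \sum_(g : 'S_m) e g.
  rewrite /u /young_symmetrizer; apply: eq_big => [p|p _].
    rewrite inE; apply/forallP => k.
    by rewrite /reshape_index /= !subn_eq0 !ltn_ord.
  have colE : col_stab m [:: m] = [set 1%g]%SET.
    apply/setP => q; rewrite !inE; apply/forallP/eqP => [qC|-> k]; last first.
      by rewrite perm1.
    apply/permP => k; rewrite perm1; apply/val_inj/eqP.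
    by have := qC k; rewrite /reshape_offset /reshape_index /= !subn_eq0 !ltn_ord /= !subn0.
  by rewrite colE big_set1 odd_perm1 expr0 scale1r mul1g.
have ug g : u *m aG g = u.
  rewrite uE mulmx_suml [RHS](reindex_inj (mulIg g)).
  by apply: eq_bigr => h _; rewrite regular_repr_delta.
have u0 : u != 0.
  apply/eqP => /rowP /(_ (gring_index G 1%g)); rewrite uE summxE !mxE.
  rewrite (bigD1 1%g) //= !mxE !eqxx big1 => [/eqP|g g1]; first by rewrite addr0 oner_eq0.
  rewrite !mxE /=; case: eqP => // /(congr1 enum_val).
  by rewrite !gring_indexK ?in_setT // => /esym/eqP; rewrite (negPf g1).
have Uu : (cyclic_mx aG u :=: u)%MS.
  apply/eqmxP; rewrite cyclic_mx_id andbT; apply: cyclic_mx_sub => //.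
  by apply/mxmoduleP => g _; rewrite ug.
rewrite /sym_char [specht_repr _ _ _ _](_ : _ = 1%:M).
  by rewrite mxtrace1 Uu rank_rV u0.
rewrite /specht_repr /= /submod_mx.
have UF : (cyclic_mx aG u <= rfix_mx aG G)%MS.
  by rewrite Uu; apply/rfix_mxP => g _; exact: ug.
have WF : (val_submod (1%:M : 'M[F]_(\rank (cyclic_mx aG u))) <= rfix_mx aG G)%MS.
  by apply: submx_trans UF; rewrite val_submod1.
by rewrite (rfix_mxP G WF) ?in_setT // val_submodK.
Qed.

(** The witness swaps the first cells of the first two rows, numbered 0 and [a]; both lie in column
    0. *)
Lemma odd_col_stab (la : seq nat) :
  sumn la = m -> (0 < nth 0 la 0)%N -> (0 < nth 0 la 1)%N ->
  exists2 t : 'S_m, t \in col_stab m la & (t : bool).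
Proof.
case: la => [|a [|b la]] //= def_m a0 b0.
have m0 : (0 < m)%N by rewrite -def_m ltn_addr.
have ma : (a < m)%N by rewrite -def_m -addn1 leq_add2l ltn_addr.
pose x := Ordinal m0; pose y := Ordinal ma.
have offx : reshape_offset [:: a, b & la] x = 0%N.
  by have := @flatten_indexKr [:: a, b & la] 0 0 a0.
have offy : reshape_offset [:: a, b & la] y = 0%N.
  have := @flatten_indexKr [:: a, b & la] 1 0 b0.
  by rewrite /flatten_index /= !addn0.
exists (tperm x y).
  by rewrite inE; apply/forallP => k; case: tpermP => [->|->|]; rewrite ?offx ?offy.
by rewrite odd_tperm -val_eqE /= eq_sym -lt0n.
Qed.

End SymmetricCharacters.

(** * Pairs of fixed-point-free involutions *)

(** Serves to turn equality of two multisets of class sizes into a size-preserving matching of the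
    classes. *)
Lemma perm_map_lift (T1 T2 T3 : eqType) (f : T1 -> T3) (g : T2 -> T3)
    (s1 : seq T1) (s2 : seq T2) :
  perm_eq (map f s1) (map g s2) ->
  exists2 s3, perm_eq s3 s2 & map f s1 = map g s3.
Proof.
elim: s1 s2 => [|x s1 IHs] s2 /=.
  by rewrite perm_sym => /perm_nilP/eqP; case: s2 => // _; exists [::].
move=> Es; have /mapP[y y2 fxE] : f x \in map g s2.
  by rewrite -(perm_mem Es) mem_head.
have Es2 := perm_to_rem y2.
move: Es; rewrite (permPr (perm_map g Es2)) /= fxE perm_cons => /IHs[s3 E3 ->].
by exists (y :: s3); rewrite ?(permPr Es2) ?perm_cons.
Qed.

Lemma connect_closed_ind (T : finType) (e : rel T) (P : T -> Prop) (x z : T) :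
  (forall u v, P u -> e u v -> P v) -> P x -> connect e x z -> P z.
Proof.
move=> Pe Px /connectP[p ep ->]; elim: p x Px ep => //= y p IHp x Px.
by case/andP=> exy; apply: IHp; apply: Pe exy.
Qed.

Section Dihedral.
Variables (T : finType) (a b : {perm T}).
Hypotheses (aK : involutive a) (bK : involutive b).
Hypotheses (a_nfix : forall x, a x != x) (b_nfix : forall x, b x != x).

(** The union of two perfect matchings: its components are cycles, possibly of length 2, in which
    [a]-edges and [b]-edges alternate. *)
Definition dihedral_rel : rel T := [rel x y | (y == a x) || (y == b x)].
Local Notation e := dihedral_rel.
Definition dihedral_class (x : T) : {set T} := [set y | connect e x y]%SET.
Definition dihedral_classes : {set {set T}} :=
  [set dihedral_class x | x : T]%SET.
(** Two steps along an alternating cycle. Each component splits into two orbits of [rotation] of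
    equal size, exchanged by [a]. *)
Definition rotation : {perm T} := (b * a)%g.
Local Notation r := rotation.

Lemma rotationE x : r x = a (b x). Proof. by rewrite permM. Qed.

Lemma dihedral_sym : connect_sym e.
Proof.
apply: sym_connect_sym => x y /=.
by congr (_ || _); apply/eqP/eqP => ->; rewrite ?aK ?bK.
Qed.

Let r_sym := fconnect_sym (@perm_inj _ r).

(** Descent by two: [iter m.+2 r x = a x] yields [iter m r (r x) = b x = a (r x)], and the descent
    ends at a fixed point of [a] or of [b]. *)
Lemma iter_rotation_neq m x : iter m r x != a x.
Proof.
elim/ltn_ind: m x => -[|[|m]] IHm x.
- by rewrite /= eq_sym a_nfix.
- by rewrite /= rotationE (inj_eq perm_inj) b_nfix.
have : iter m r (r x) != a (r x) by apply: IHm; rewrite ltnS leqnSn.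
apply: contraNneq; rewrite iterS rotationE => /perm_inj/(congr1 b).
by rewrite bK iterSr => ->; rewrite rotationE aK.
Qed.

Lemma fconnect_rotation_flip x y :
  fconnect r x y -> fconnect r x (a y) = false.
Proof.
move=> rxy; apply/negP => rxay.
have : fconnect r y (a y) by rewrite (connect_trans _ rxay) // r_sym.
by case/iter_findex => /eqP; apply/negP/iter_rotation_neq.
Qed.

(** The orbit of x under [r] together with its image under [a] is stable under [a], and also under
    [b] because [a (b u) = r u] and [r (b u) = a u]. *)
Lemma dihedral_connectE x y :
  connect e x y = fconnect r x y || fconnect r x (a y).
Proof.
apply/idP/idP => [|].
  apply: (@connect_closed_ind _ _
    (fun y => fconnect r x y || fconnect r x (a y))); last by rewrite connect0.
  move=> u v uP /orP[] /eqP ->; first by rewrite aK orbC.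
  have -> : a (b u) = r u by rewrite rotationE.
  have Eau : r (b u) = a u by rewrite rotationE bK.
  rewrite orbC; case/orP: uP => [|uP].
    by rewrite (same_connect_r r_sym (fconnect1 r u)) => ->.
  apply/orP; right; rewrite (same_connect_r r_sym (fconnect1 r (b u))).
  by rewrite Eau.
have rP u : fconnect r x u -> connect e x u.
  apply: (@connect_closed_ind _ _ (fun u => connect e x u)) => [{}u v xu|].
    move=> /eqP <-; apply: connect_trans xu _; rewrite rotationE.
    apply: (@connect_trans _ _ (b u)); apply: connect1.
      by rewrite /dihedral_rel /= eqxx orbT.
    by rewrite /dihedral_rel /= eqxx.
  exact: connect0.
case/orP=> /rP // xay; apply: connect_trans xay _.
by apply: connect1; rewrite /dihedral_rel /= aK eqxx.
Qed.

Lemma card_dihedral_class x : #|dihedral_class x| = (fingraph.order r x).*2.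
Proof.
rewrite /fingraph.order -addnn.
rewrite (_ : #|dihedral_class x| =
             #|[predU fconnect r x & [pred y | fconnect r x (a y)]]|); last first.
  by apply: eq_card => y; rewrite !inE dihedral_connectE.
have Ea : #|[pred y | fconnect r x (a y)]| = #|fconnect r x|.
  rewrite -(fintype.card_image (@perm_inj _ a) [pred y | fconnect r x (a y)]).
  apply: eq_card => y; apply/fintype.imageP/idP => [[z /= xz ->] //|xy].
  by exists (a y); rewrite ?aK // inE aK.
rewrite -{2}Ea -cardUI [X in (_ = _ + X)%N]eq_card0 ?addn0 // => y.
rewrite !inE; apply/negP => /andP[xy].
by rewrite fconnect_rotation_flip.
Qed.

Lemma card_half_dihedral_class x : #|dihedral_class x|./2 = fingraph.order r x.
Proof. by rewrite card_dihedral_class doubleK. Qed.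

Lemma dihedral_class_sum : (\sum_(B in dihedral_classes) #|B|./2).*2 = #|T|.
Proof.
have -> : dihedral_classes = equivalence_partition (connect e) [set: T]%SET.
  apply/setP=> B; apply/imsetP/imsetP => -[x _ ->]; exists x => //;
    by apply/setP => y; rewrite !inE.
have eqR : {in [set: T]%SET & &, equivalence_rel (connect e)}.
  move=> x y z _ _ _; split; first exact: connect0.
  by move=> xy; rewrite (same_connect dihedral_sym xy).
rewrite -cardsT (card_partition (equivalence_partitionP eqR)).
rewrite -muln2 big_distrl; apply: eq_bigr => B /imsetP[x _ ->] /=.
have -> : [set y in [set: T] | connect e x y]%SET = dihedral_class x.
  by apply/setP => y; rewrite !inE.
by rewrite card_half_dihedral_class card_dihedral_class muln2.
Qed.

End Dihedral.

(** * Simultaneous conjugacy of pairs of involutions *)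

Section DihedralConjugacy.
Variables (T : finType) (a b c : {perm T}).
Hypotheses (aK : involutive a) (bK : involutive b) (cK : involutive c).
Hypotheses (a_nfix : forall x, a x != x).
Hypotheses (b_nfix : forall x, b x != x) (c_nfix : forall x, c x != x).

(** Match the classes by size and choose a base point in each. The orbit of a base point is carried
    along by powers of the rotations, the other half of the class by commuting with [a]. Commutation
    with [b] follows from [b y = a (r y)]. *)
Lemma dihedral_conjugacy :
  perm_eq [seq #|B|./2 | B : {set T} <- enum (dihedral_classes a b)]
          [seq #|B|./2 | B : {set T} <- enum (dihedral_classes a c)] ->
  exists h : {perm T},
    (forall x, h (a x) = a (h x)) /\ (forall x, h (b x) = c (h x)).
Proof.
move=> /perm_map_lift[s3 E3 Es].
pose phi (B : {set T}) := nth finset.set0 s3 (index B (enum (dihedral_classes a b))).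
have sz3 : size s3 = size (enum (dihedral_classes a b)).
  by rewrite -(size_map (fun B : {set T} => #|B|./2)) -Es size_map.
have clsP x : dihedral_class a b x \in enum (dihedral_classes a b).
  by rewrite mem_enum; apply/imsetP; exists x.
have phi_in x : phi (dihedral_class a b x) \in dihedral_classes a c.
  by rewrite -mem_enum -(perm_mem E3) mem_nth // sz3 index_mem.
have phi_card x :
    #|phi (dihedral_class a b x)|./2 = #|dihedral_class a b x|./2.
  rewrite -[LHS](nth_map finset.set0 0%N (fun B : {set T} => #|B|./2)) -?Es.
    by rewrite (nth_map finset.set0) ?index_mem // nth_index.
  by rewrite sz3 index_mem.
have phi_surj z : exists x, phi (dihedral_class a b x) = dihedral_class a c z.
  have : dihedral_class a c z \in s3.
    by rewrite (perm_mem E3) mem_enum; apply/imsetP; exists z.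
  case/(nthP finset.set0) => i; rewrite sz3 => lti <-.
  have := mem_nth finset.set0 lti; rewrite mem_enum => /imsetP[x _ Ex].
  by exists x; rewrite /phi -Ex index_uniq ?enum_uniq.
(* A base point in the matched class; the default never occurs, since that class is nonempty. *)
pose f x := odflt x [pick z in phi (dihedral_class a b x)].
have f_in x : f x \in phi (dihedral_class a b x).
  rewrite /f; case: pickP => //= phi0.
  have /imsetP[z _ Ez] := phi_in x; have := phi0 z.
  by rewrite Ez inE connect0.
pose e := dihedral_rel a b; pose r := rotation a b; pose r' := rotation a c.
have f_order x : fingraph.order r' (f x) = fingraph.order r x.
  rewrite -!card_half_dihedral_class // -phi_card.
  have /imsetP[z _ Ez] := phi_in x; rewrite Ez.
  have := f_in x; rewrite Ez inE => zf.
  suff -> : dihedral_class a c (f x) = dihedral_class a c z by [].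
  apply/setP => y; rewrite !inE.
  by rewrite (same_connect (dihedral_sym aK cK) zf).
pose K x y := iter (findex r x y) r' (f x).
have KS x y : fconnect r x y -> K x (r y) = r' (K x y).
  move=> xy; rewrite /K -iterS; have lti := findex_max xy.
  have Ey := iter_findex xy; move: (findex r x y) lti Ey => i lti <-.
  (* At the end of the cycle [findex] returns to 0, and [r'] closes up at the same moment because
     the two orders agree. *)
  rewrite -iterS; move: lti; rewrite leq_eqVlt => /orP[/eqP Ei|lti].
    rewrite Ei iter_order ?findex0; last exact: perm_inj.
    by rewrite -f_order iter_order //; exact: perm_inj.
  by rewrite findex_iter.
pose rt := fingraph.root e.
have symE : connect_sym e := dihedral_sym aK bK.
have rtP y : fconnect r (rt y) y || fconnect r (rt y) (a y).
  by rewrite -dihedral_connectE // symE connect_root.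
have rt_a y : rt (a y) = rt y.
  apply/esym/eqP; rewrite root_connect //; apply: connect1.
  by rewrite /e /dihedral_rel /= eqxx.
have rt_b y : rt (b y) = rt y.
  apply/esym/eqP; rewrite root_connect //; apply: connect1.
  by rewrite /e /dihedral_rel /= eqxx orbT.
have rt_r y : rt (r y) = rt y by rewrite rotationE rt_a rt_b.
pose h0 y := if fconnect r (rt y) y then K (rt y) y else a (K (rt y) (a y)).
have rxyN x y : fconnect r x y -> fconnect r x (a y) = false.
  exact: fconnect_rotation_flip.
have h0a y : h0 (a y) = a (h0 y).
  rewrite /h0 rt_a aK; case: ifP => [xay|xay].
    by have := rxyN _ _ xay; rewrite aK => ->; rewrite aK.
  by have := rtP y; rewrite xay orbF => ->.
have r_conn x y : fconnect r x (r y) = fconnect r x y.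
  rewrite [RHS](same_connect_r _ (fconnect1 r y)) //.
  exact: (fconnect_sym (@perm_inj _ r)).
have h0r y : h0 (r y) = r' (h0 y).
  rewrite /h0 rt_r r_conn; case: ifP => [xy|xy]; first exact: KS.
  have xay : fconnect r (rt y) (a y) by have := rtP y; rewrite xy.
  have Eby : a (r y) = b y by rewrite rotationE aK.
  have Eay : r (b y) = a y by rewrite rotationE bK.
  have xby : fconnect r (rt y) (b y) by rewrite -r_conn Eay.
  by rewrite Eby -Eay KS // !rotationE aK cK.
have h0b y : h0 (b y) = c (h0 y).
  have -> : b y = a (r y) by rewrite rotationE aK.
  by rewrite h0a h0r rotationE aK.
(* The image of [h0] is stable under [a] and [c] and meets every class of the target. *)
have h0_surj z : exists y, h0 y = z.
  have [w Ew] := phi_surj z; pose x := rt w.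
  have Ecl : dihedral_class a b x = dihedral_class a b w.
    apply/setP => y; rewrite !inE; apply: (same_connect symE).
    by rewrite symE connect_root.
  have h0x : h0 x = f x.
    by rewrite /h0 /x /rt (root_root symE) connect0 /K findex0.
  have := f_in x; rewrite Ecl Ew inE (dihedral_sym aK cK).
  apply: (@connect_closed_ind _ _ (fun z => exists y, h0 y = z)).
    by move=> u v [y <-] /orP[] /eqP ->; [exists (a y) | exists (b y)].
  by exists x.
(* A right inverse [g] of [h0] is injective, hence a permutation of a finite set, and [h0] is its
   inverse. *)
have [g gP] := fin_all_exists h0_surj.
have g_inj : injective g by exact: can_inj gP.
exists (perm g_inj)^-1%g.
have hE y : (perm g_inj)^-1%g y = h0 y.
  by rewrite -{2}(permKV (perm g_inj) y) permE gP.
by split=> x; rewrite !hE.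
Qed.

End DihedralConjugacy.

(** * Pair partitions and coset-types *)

Section PairPartitions.
Variable n : nat.
Local Notation T := 'I_n.*2.

Definition flip : 'S_n.*2 := (\prod_(k < n) tperm (lo k) (hi k))%g.

Lemma lo_hi_neq (k j : 'I_n) : lo k != hi j.
Proof.
by apply/eqP => /(congr1 (fun x : T => odd x)); rewrite /= !odd_double.
Qed.

Lemma lo_inj : injective (@lo n).
Proof. by move=> k j /(congr1 (fun x : T => x./2)) /=; rewrite !doubleK => /val_inj. Qed.

Lemma hi_inj : injective (@hi n).
Proof.
by move=> k j /(congr1 (fun x : T => x./2)) /=; rewrite !uphalf_double => /val_inj.
Qed.

Lemma lo_hiP (x : T) : exists k : 'I_n, x = lo k \/ x = hi k.
Proof.
have ltk : (x./2 < n)%N by rewrite ltn_half_double.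
exists (Ordinal ltk); case Ex: (odd x); [right | left]; apply: val_inj => /=;
  by rewrite -{1}[val x](odd_double_half x) Ex.
Qed.

Lemma flip_lo_hi (j : 'I_n) : flip (lo j) = hi j /\ flip (hi j) = lo j.
Proof.
(* Generalized to partial products of the disjoint transpositions, so that induction on the list
   applies. *)
suff flipP (r : seq 'I_n) : uniq r ->
    let p := (\prod_(k <- r) tperm (lo k) (hi k))%g in
    p (lo j) = (if j \in r then hi j else lo j) /\
    p (hi j) = (if j \in r then lo j else hi j).
  by have := flipP _ (index_enum_uniq _); rewrite mem_index_enum.
elim: r => [|k r IHr] /=; first by rewrite big_nil !perm1.
case/andP=> kr /IHr[Elo Ehi]; rewrite big_cons !permM inE.
have [ejk|jk] := eqVneq j k.
  by rewrite -ejk in kr *; rewrite tpermL tpermR Elo Ehi (negPf kr).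
rewrite !tpermD ?(inj_eq lo_inj) ?(inj_eq hi_inj) 1?eq_sym ?lo_hi_neq //.
by rewrite eq_sym lo_hi_neq.
Qed.

Lemma flipK : involutive flip.
Proof.
by move=> x; have [k [->|->]] := lo_hiP x; have [E1 E2] := flip_lo_hi k;
  rewrite ?E1 ?E2.
Qed.

Lemma flip_nfix x : flip x != x.
Proof.
have [k [->|->]] := lo_hiP x; have [E1 E2] := flip_lo_hi k.
  by rewrite E1 eq_sym lo_hi_neq.
by rewrite E2 lo_hi_neq.
Qed.

Lemma conj_flipE (s : 'S_n.*2) x : (flip ^ s)%g x = s (flip ((s^-1)%g x)).
Proof. by rewrite conjgE !permM. Qed.

Lemma conj_flipK (s : 'S_n.*2) : involutive (flip ^ s)%g.
Proof. by move=> x; rewrite !conj_flipE permK flipK permKV. Qed.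

Lemma conj_flip_nfix (s : 'S_n.*2) x : (flip ^ s)%g x != x.
Proof.
rewrite conj_flipE -{2}(permKV s x) (inj_eq perm_inj); exact: flip_nfix.
Qed.

(** Encodes a pair partition as the involution [flip ^ s], which exchanges [s (lo k)] and
    [s (hi k)]. *)
Lemma pairs_ofE (s : 'S_n.*2) :
  pairs_of s = [set [set x; (flip ^ s)%g x]%SET | x : T]%SET.
Proof.
apply/setP => B; apply/imsetP/imsetP => [[k _ ->]|[x _ ->]].
  by exists (s (lo k)); rewrite // permJ (flip_lo_hi k).1.
have [k [Ek|Ek]] := lo_hiP ((s^-1)%g x); exists k; rewrite // conj_flipE Ek.
  by rewrite (flip_lo_hi k).1 -Ek permKV.
by rewrite (flip_lo_hi k).2 -Ek permKV finset.setUC.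
Qed.

Lemma mem_pairs_of (s : 'S_n.*2) x y :
  ([set x; y]%SET \in pairs_of s) = (y == (flip ^ s)%g x).
Proof.
rewrite pairs_ofE; apply/imsetP/eqP => [[z _ /setP E]|->]; last by exists x.
have nz := conj_flip_nfix s z; have := E ((flip ^ s)%g z); have := E z.
have := E x; rewrite !inE !eqxx !orbT => /esym/orP[] /eqP ->.
  by move=> _; rewrite (negPf nz) /= => /eqP.
by rewrite eq_sym (negPf nz) conj_flipK /= => /eqP.
Qed.

Lemma pairs_of_inj (s t : 'S_n.*2) :
  pairs_of s = pairs_of t <-> (flip ^ s = flip ^ t)%g.
Proof.
split=> [E|E]; last by rewrite !pairs_ofE E.
by apply/permP => x; apply/eqP; rewrite -mem_pairs_of -E mem_pairs_of.
Qed.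

(** [flip ^ t = flip ^ s] means that [t * s^-1] commutes with [flip]. *)
Lemma pairs_of_coset (s t : 'S_n.*2) :
  (pairs_of t == pairs_of s) = (t \in hyperoctahedral n :* s)%g.
Proof.
rewrite mem_rcoset; apply/eqP/cent1P => [/pairs_of_inj E|E].
  by apply/commute_sym/commgP/conjg_fixP; rewrite conjgM E -conjgM mulgV conjg1.
by apply/pairs_of_inj; move/commute_sym/commgP/conjg_fixP: E => /(congr1 (fun x => x ^ s)%g);
   rewrite -conjgM mulgKV.
Qed.

Lemma pair_graphE (s : 'S_n.*2) :
  pair_graph (pairs_of s) =2 dihedral_rel flip (flip ^ s)%g.
Proof. by move=> x y; rewrite /pair_graph inE !mem_pairs_of conjg1. Qed.

Lemma coset_type_perm (s : 'S_n.*2) :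
  coset_type s = sort geq [seq #|B|./2 | B : {set T} <- enum
     (dihedral_classes flip (flip ^ s)%g)].
Proof.
rewrite /coset_type /coset_type_of; congr (sort _ [seq _ | _ <- enum (pred_of_set _)]).
apply/setP=> B; apply/imsetP/imsetP => -[x _ ->]; exists x => //;
  by apply/setP => y; rewrite !inE (eq_connect (pair_graphE s)).
Qed.

Lemma coset_type_is_part (s : 'S_n.*2) : is_part n (coset_type s).
Proof.
rewrite coset_type_perm; apply/and3P; split.
- by apply: sort_sorted => x y; exact: leq_total.
- rewrite mem_sort; apply/mapP => -[B]; rewrite mem_enum => /imsetP[x _ ->].
  rewrite card_half_dihedral_class; [|exact: flipK|exact: conj_flipK|
    exact: flip_nfix|exact: conj_flip_nfix].
  by move=> /esym/eqP; rewrite -leqn0 leqNgt fingraph.order_gt0.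
have -> (l : seq nat) : sumn (sort geq l) = sumn l.
  by apply/perm_sumn; rewrite perm_sort.
rewrite sumnE big_map big_enum /= -(inj_eq double_inj).
by rewrite dihedral_class_sum ?card_ord //;
  [exact: flipK|exact: conj_flipK|exact: flip_nfix|exact: conj_flip_nfix].
Qed.

(** Equal coset-types make the pairs ([flip], [flip ^ s]) and ([flip], [flip ^ t]) conjugate by one
    [h]. It commutes with [flip], and [flip ^ (s * h) = flip ^ t] places [t] in the right coset of
    [s * h]. *)
Lemma coset_type_conj (s t : 'S_n.*2) : coset_type s = coset_type t ->
  exists h k : 'S_n.*2, [/\ h \in hyperoctahedral n, k \in hyperoctahedral n &
    t = (k * s * h)%g].
Proof.
rewrite !coset_type_perm => /perm_sortP Est.
have /dihedral_conjugacy[] : perm_eq _ _ := Est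
  (fun x y => leq_total y x) (fun x y z yx zx => leq_trans zx yx)
  (fun x y => fun xy => anti_leq (etrans (andbC _ _) xy));
  [exact: flipK|exact: conj_flipK|exact: conj_flipK
  |exact: flip_nfix|exact: conj_flip_nfix|exact: conj_flip_nfix|].
move=> h [ha hb]; exists h, (t * (s * h)^-1)%g; split; last first.
- by rewrite -mulgA mulgKV.
- rewrite -mem_rcoset -pairs_of_coset; apply/eqP/pairs_of_inj.
  rewrite conjgM; apply/permP => x.
  by rewrite -{2}(permKV h x) permJ hb permKV.
apply/cent1P/permP => x; rewrite !permM.
by rewrite -/flip ha.
Qed.

Lemma pair_partition_pairs_of (s : 'S_n.*2) : pair_partition (pairs_of s).
Proof.
pose b := (flip ^ s)%g.
have bE x z : z \in [set x; b x]%SET -> [set x; b x]%SET = [set z; b z]%SET.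
  by rewrite !inE => /orP[/eqP -> //|/eqP ->]; rewrite conj_flipK finset.setUC.
rewrite /pair_partition pairs_ofE; apply/andP; split; last first.
  apply/forallP => B; apply/implyP => /imsetP[x _ ->].
  by rewrite cards2 (eq_sym x) conj_flip_nfix.
apply/and3P; split.
- apply/eqP/setP => x; rewrite inE; apply/bigcupP.
  by exists [set x; b x]%SET; [apply/imsetP; exists x | rewrite !inE eqxx].
- apply/finset.trivIsetP => _ _ /imsetP[x _ ->] /imsetP[y _ ->]; apply: contraNT.
  by case/pred0Pn => z /andP[/= /bE -> /bE ->].
apply/imsetP => -[x _ /setP/(_ x)]; by rewrite !inE eqxx.
Qed.

Lemma card_pair_partition (P : {set {set T}}) : pair_partition P -> #|P| = n.
Proof.
case/andP=> partP /forallP cardP.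
have P2 : {in P, forall B : {set T}, #|B| = 2%N}.
  by move=> B PB; exact/eqP/(implyP (cardP B)).
have := card_uniform_partition P2 partP; rewrite cardsT card_ord muln2.
by move=> /double_inj.
Qed.

(** Enumerate the blocks and the elements of each block: the point 2k + e, with e in {0, 1}, goes to
    element e of block k. *)
Lemma pairs_of_surj (P : {set {set T}}) :
  pair_partition P -> exists s : 'S_n.*2, P = pairs_of s.
Proof.
move=> ppP; have cP := card_pair_partition ppP.
case/andP: (ppP) => /and3P[_ tP _] /forallP cardP.
pose blk (x : T) := nth finset.set0 (enum P) x./2.
have ltx (x : T) : (x./2 < size (enum P))%N.
  by rewrite -cardE cP ltn_half_double.
have blkP x : blk x \in P by rewrite -mem_enum mem_nth.
have blk2 x : #|blk x| = 2%N by exact/eqP/(implyP (cardP _)).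
pose s0 (x : T) := nth x (enum (blk x)) (odd x).
have lto (x : T) : (odd x < size (enum (blk x)))%N by rewrite -cardE blk2; case: odd.
have s0P x : s0 x \in blk x by rewrite -mem_enum mem_nth.
have s0_inj : injective s0.
  move=> x y Exy; have Eb : blk x = blk y.
    by rewrite -(def_pblock tP (blkP x) (s0P x)) Exy (def_pblock tP (blkP y) (s0P y)).
  have /eqP := Eb; rewrite /blk nth_uniq ?enum_uniq // => /eqP Eh.
  move/eqP: Exy; rewrite /s0 -Eb (set_nth_default x) -?Eb //; last by rewrite Eb.
  rewrite nth_uniq ?enum_uniq //; last by rewrite Eb.
  move=> /eqP Eo; apply: val_inj; rewrite /= -(odd_double_half x) Eh Eo.
  exact: odd_double_half.
exists (perm s0_inj); apply/esym/eqP; rewrite eqEcard cP.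
rewrite (card_pair_partition (pair_partition_pairs_of _)) leqnn andbT.
apply/fintype.subsetP => _ /imsetP[k _ ->]; rewrite !permE.
suff -> : [set s0 (lo k); s0 (hi k)]%SET = blk (lo k) by [].
have Ehl : blk (hi k) = blk (lo k) by rewrite /blk /= uphalf_double doubleK.
apply/eqP; rewrite eqEcard blk2 cards2 (inj_eq s0_inj) lo_hi_neq andbT.
apply/fintype.subsetP => x; rewrite !inE => /orP[] /eqP ->; first exact: s0P.
by rewrite -Ehl s0P.
Qed.

(** The fibres of [pairs_of] over pair partitions are right cosets of the hyperoctahedral group. *)
Lemma card_coset_type (la : intpart n) :
  #|[set s : 'S_n.*2 | coset_type s == la]%SET| =
  (#|hyperoctahedral n| * num_coset_type la)%N.
Proof.
rewrite -sum1_card (partition_big (@pairs_of n) (fun P =>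
  pair_partition P && (coset_type_of P == la))) /=; last first.
  by move=> s; rewrite inE pair_partition_pairs_of.
rewrite mulnC /num_coset_type -sum1dep_card big_distrl /=.
apply: eq_bigr => P /andP[/pairs_of_surj[s ->] Pla].
rewrite mul1n -(card_rcoset _ s) sum1dep_card; apply: eq_card => t.
rewrite !inE -pairs_of_coset; apply: andb_idl => /eqP Et.
by rewrite /coset_type Et.
Qed.

Lemma sum_coset_type (F : numFieldType) (w : 'S_n.*2 -> F) (wp : intpart n -> F) :
  (forall s (la : intpart n), coset_type s = la -> w s = wp la) ->
  \sum_(la : intpart n) (num_coset_type la)%:R * wp la =
  (#|hyperoctahedral n|%:R)^-1 * \sum_(s : 'S_n.*2) w s.
Proof.
move=> wE; pose ct (s : 'S_n.*2) := IntPart (coset_type_is_part s).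
rewrite [in RHS](partition_big ct predT) //= big_distrr /=.
apply: eq_bigr => la _.
rewrite (eq_bigr (fun=> wp la)) => [|s /eqP <-]; last exact: wE.
have H0 : #|hyperoctahedral n|%:R != 0 :> F by rewrite pnatr_eq0 -lt0n cardG_gt0.
rewrite sumr_const -[wp la *+ _]mulr_natl mulrA; congr (_ * _).
have -> : #|[pred s | ct s == la]| = (#|hyperoctahedral n| * num_coset_type la)%N.
  by rewrite -card_coset_type; apply: eq_card => s; rewrite !inE -val_eqE.
by rewrite natrM mulKf.
Qed.

End PairPartitions.

(** * The sum of the Weingarten function *)

Lemma prod_shift_neq0 (F : numFieldType) (d n : nat) : (0 < d)%N ->
  \prod_(j < n) (d%:R + 2 * j%:R) != 0 :> F.
Proof.
move=> d0; apply/prodf_neq0 => j _.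
by rewrite -natrM -natrD pnatr_eq0 -lt0n ltn_addr.
Qed.

Section WeingartenSum.
Variables (F : numFieldType) (d n : nat).
Local Notation H := (hyperoctahedral n).

Lemma zonal_sphericalMr (la : intpart n) (s h : 'S_n.*2) : h \in H ->
  zonal_spherical F la (s * h)%g = zonal_spherical F la s.
Proof.
move=> hH; rewrite /zonal_spherical; congr (_ * _).
rewrite [RHS](reindex_inj (mulgI h)) /=.
by apply: eq_big => [k|k _]; rewrite ?groupMl // mulgA.
Qed.

(** The character is a class function, so h moves from the left to the right, where the sum over the
    group absorbs it. *)
Lemma zonal_sphericalMl (la : intpart n) (s h : 'S_n.*2) : h \in H ->
  zonal_spherical F la (h * s)%g = zonal_spherical F la s.
Proof.
move=> hH; rewrite /zonal_spherical; congr (_ * _).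
rewrite [RHS](reindex_inj (mulIg h)) /=.
apply: eq_big => [k|k _]; first by rewrite groupMr.
by rewrite -mulgA [LHS]sym_charC mulgA.
Qed.

Lemma weingarten_coset_type (s t : 'S_n.*2) : coset_type s = coset_type t ->
  weingarten F d s = weingarten F d t.
Proof.
case/coset_type_conj=> h [k [hH kH ->]]; rewrite /weingarten; congr (_ * _).
by apply: eq_bigr => la _; rewrite zonal_sphericalMr // zonal_sphericalMl.
Qed.

Lemma weingarten_partE (s : 'S_n.*2) (la : intpart n) :
  coset_type s = la -> weingarten F d s = weingarten_part F d la.
Proof.
move=> sla; rewrite /weingarten_part; case: pickP => [t /eqP tla|/(_ s)].
  by apply: weingarten_coset_type; rewrite sla tla.
by rewrite sla eqxx.
Qed.

(** Translation by each h leaves the sum over all permutations unchanged, so h contributes only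
    through [#|H|]. *)
Lemma sum_zonal_spherical (la : intpart n) :
  \sum_(s : 'S_n.*2) zonal_spherical F la s =
  ((2 ^ n * n`!)%:R)^-1 * #|H|%:R *
  \sum_(s : 'S_n.*2) sym_char F (double_part la) s.
Proof.
rewrite -mulrA -big_distrr /=; congr (_ * _).
rewrite exchange_big /= (eq_bigr (fun=> \sum_(s : 'S_n.*2) sym_char F (double_part la) s)).
  by rewrite sumr_const mulr_natl.
by move=> h _; rewrite [RHS](reindex_inj (mulIg h)).
Qed.

Lemma sum_sym_char_double_eq0 (la : intpart n) : (1 < size la)%N ->
  \sum_(s : 'S_n.*2) sym_char F (double_part la) s = 0.
Proof.
case: la => -[|x [|y la]] //= /and3P[_]; rewrite !inE !negb_or.
case/and3P => x0 y0 _ /eqP Es _.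
have [|//||t tC t1] := @odd_col_stab n.*2 (double_part [:: x, y & la]).
- rewrite -{}Es /double_part /= !doubleD; congr (_ + (_ + _))%N.
  by elim: la => //= z la ->; rewrite doubleD.
- by rewrite /= double_gt0 lt0n eq_sym.
- by rewrite /= double_gt0 lt0n eq_sym.
exact: sum_sym_char_eq0 t1 tC.
Qed.

Lemma sum_weingarten : (0 < d)%N -> (0 < n)%N ->
  \sum_(s : 'S_n.*2) weingarten F d s =
  #|H|%:R / \prod_(j < n) (d%:R + 2 * j%:R).
Proof.
move=> d0 n0.
have n_part : is_part n [:: n].
  by rewrite /is_part /= inE eq_sym -lt0n n0 addn0 eqxx.
pose top := IntPart n_part.
rewrite /weingarten -big_distrr /= exchange_big /= (bigD1 top) //=.
rewrite [X in _ + X]big1 ?addr0 => [|la /andP[_ la_top]]; last first.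
  rewrite -big_distrr /= sum_zonal_spherical sum_sym_char_double_eq0 ?mulr0 //.
  (* A partition of n other than [top] with at most one part would be empty, against [n0]. *)
  case: la la_top => -[|x [|y la]] laP // la_top.
    by case/and3P: (laP) => _ _ /eqP E; move: n0; rewrite -[X in (0 < X)%N]E.
  case/eqP: la_top; apply: val_inj => /=.
  by case/and3P: laP => _ _ /=; rewrite addn0 => /eqP ->.
rewrite -big_distrr /= sum_zonal_spherical /=.
rewrite (eq_bigr (fun=> 1)) => [|s _]; last by rewrite sym_char_trivial.
rewrite sym_char_trivial sumr_const card_Sn.
rewrite /jack2_one /= big_ord1 /= mul2n.
under eq_bigr do rewrite subr0.
have f0 k : (k`!)%:R != 0 :> F by rewrite pnatr_eq0 -lt0n fact_gt0.
have p0 : (2 ^ n * n`!)%:R != 0 :> F by rewrite pnatr_eq0 -lt0n muln_gt0 expn_gt0 fact_gt0.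
set p := \prod_(j < n) _; set q := (2 ^ n * n`!)%:R; set f := (n.*2)`!%:R.
have p_neq0 : p != 0 by exact: prod_shift_neq0.
(* The factors $2^n n!$ and $(2n)!$ cancel; [#|H|] remains, to be cancelled by the one in
   [sum_coset_type]. *)
suff fieldE (x y z w : F) : x != 0 -> y != 0 -> z != 0 ->
  x / y * (1 / z * (x^-1 * w * y)) = w / z by exact: fieldE p0 (f0 _) p_neq0.
by move=> x0 y0 z0; field; rewrite z0 x0 y0.
Qed.

End WeingartenSum.

(** * Integration on the orthogonal group *)

Section BoundedMeasurable.
Local Open Scope classical_set_scope.
Context (dT : measure_display) (T : measurableType dT) (R : realType).
Variable mu : probability T R.
Implicit Types f g : T -> R.

(** A class closed under sums and products and integrable for any probability measure; it contains
    all polynomials in the matrix entries. *)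
Definition bounded_measurable f : Prop :=
  measurable_fun [set: T] f /\ exists M, forall x, `|f x| <= M.
Local Notation bm := bounded_measurable.

Lemma bounded_measurable_integrable f : bm f ->
  mu.-integrable [set: T] (EFin \o f).
Proof.
move=> [mf [M fM]]; apply: measurable_bounded_integrable => //.
  by rewrite (le_lt_trans (probability_le1 _ _)) // ltry.
by exists M; split; [exact: num_real | move=> N MN x _; exact: le_trans (ltW MN)].
Qed.

Lemma bounded_measurable_cst (c : R) : bm (fun=> c).
Proof. by split; [exact: measurable_cst | exists `|c|]. Qed.

Lemma bounded_measurableD f g : bm f -> bm g -> bm (fun x => f x + g x).
Proof.
move=> [mf [M fM]] [mg [N gN]]; split; first exact: measurable_funD.
by exists (M + N) => x; rewrite (le_trans (ler_normD _ _)) // lerD.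
Qed.

Lemma bounded_measurableM f g : bm f -> bm g -> bm (fun x => f x * g x).
Proof.
move=> [mf [M fM]] [mg [N gN]]; split; first exact: measurable_funM.
by exists (M * N) => x; rewrite normrM ler_pM.
Qed.

Lemma bounded_measurableZ (c : R) f : bm f -> bm (fun x => c * f x).
Proof. by apply: bounded_measurableM; exact: bounded_measurable_cst. Qed.

Lemma bounded_measurable_sum (I : Type) (r : seq I) (F : I -> T -> R) :
  (forall i, bm (F i)) -> bm (fun x => \sum_(i <- r) F i x).
Proof.
move=> bF; elim: r => [|i r IHr].
  by under eq_fun do rewrite big_nil; exact: bounded_measurable_cst.
by under eq_fun do rewrite big_cons; exact: bounded_measurableD.
Qed.

Lemma bounded_measurable_prod (I : Type) (r : seq I) (F : I -> T -> R) :
  (forall i, bm (F i)) -> bm (fun x => \prod_(i <- r) F i x).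
Proof.
move=> bF; elim: r => [|i r IHr].
  by under eq_fun do rewrite big_nil; exact: bounded_measurable_cst.
by under eq_fun do rewrite big_cons; exact: bounded_measurableM.
Qed.

Definition mean f : R := (\int[mu]_(x in [set: T]) f x)%R.

Lemma mean_cst c : mean (fun=> c) = c.
Proof.
rewrite /mean Rintegral_cst // -[RHS]mulr1; congr (_ * _).
exact: (congr1 fine (probability_setT mu)).
Qed.

Lemma meanD f g : bm f -> bm g ->
  mean (fun x => f x + g x) = mean f + mean g.
Proof.
by move=> bf bg; apply: RintegralD => //; exact: bounded_measurable_integrable.
Qed.

Lemma meanZ c f : bm f -> mean (fun x => c * f x) = c * mean f.
Proof.
by move=> bf; apply: RintegralZl => //; exact: bounded_measurable_integrable.
Qed.

Lemma mean_sum (I : Type) (r : seq I) (F : I -> T -> R) :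
  (forall i, bm (F i)) ->
  mean (fun x => \sum_(i <- r) F i x) = \sum_(i <- r) mean (F i).
Proof.
move=> bF; elim: r => [|i r IHr].
  by under eq_fun do rewrite big_nil; rewrite mean_cst big_nil.
rewrite big_cons -IHr; under eq_fun do rewrite big_cons.
by apply: meanD => //; exact: bounded_measurable_sum.
Qed.

Lemma meanE f : bm f -> (\int[mu]_(x in [set: T]) (f x)%:E)%E = (mean f)%:E.
Proof.
move=> bf; rewrite /mean /Rintegral fineK //.
exact: integrable_fin_num (bounded_measurable_integrable bf).
Qed.

End BoundedMeasurable.

(** * Measurability and left invariance on O(d) *)

Section OrthogonalGroup.
Local Open Scope classical_set_scope.
Variables (R : realType) (d : nat).
Local Notation O := (orthogonal_group R d).
Local Notation BO := (borel_orthogonal R d).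

Lemma orthogonal_mulmxT (g : O) : omx g *m (omx g)^T = 1%:M.
Proof. exact/eqP/omxP. Qed.

Lemma orthogonal_mulTmx (g : O) : (omx g)^T *m omx g = 1%:M.
Proof. exact: mulmx1C (orthogonal_mulmxT g). Qed.

Lemma is_orthogonalT (g : O) : Defs.is_orthogonal (omx g)^T.
Proof. by rewrite /Defs.is_orthogonal trmxK orthogonal_mulTmx. Qed.

Definition orthogonal_inv (g : O) : O := Orthogonal (is_orthogonalT g).

Lemma orthogonal_mulKV (g h : O) :
  orthogonal_mul g (orthogonal_mul (orthogonal_inv g) h) = h.
Proof. by apply: val_inj; rewrite /= mulmxA orthogonal_mulmxT mul1mx. Qed.

Lemma orthogonal_mulK (g h : O) :
  orthogonal_mul (orthogonal_inv g) (orthogonal_mul g h) = h.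
Proof. by apply: val_inj; rewrite /= mulmxA orthogonal_mulTmx mul1mx. Qed.

Lemma orthogonal_col_sum (g : O) (j : 'I_d) : \sum_i omx g i j * omx g i j = 1.
Proof.
have /matrixP/(_ j j) := orthogonal_mulTmx g; rewrite !mxE eqxx => E1.
by apply: etrans E1; apply: eq_bigr => i _; rewrite mxE.
Qed.

Lemma orthogonal_entry_le1 (g : O) (i j : 'I_d) : `|omx g i j| <= 1.
Proof.
rewrite -(@expr_le1 _ 2) // real_normK ?num_real //.
rewrite -(orthogonal_col_sum g j) (bigD1 i) //= -expr2 lerDl sumr_ge0 // => k _.
by rewrite -expr2 sqr_ge0.
Qed.

Lemma omx_continuous : continuous (@omx R d).
Proof. exact: initial_continuous. Qed.

Lemma entry_continuous (i j : 'I_d) : continuous (fun g : O => omx g i j).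
Proof.
move=> g; apply: (continuous_comp (f := @omx R d) (g := fun M : 'M[R]_d => M i j)).
  exact: omx_continuous.
exact: coord_continuous.
Qed.

(** Open intervals generate the Borel sets of the line, and their preimages are open. *)
Lemma continuous_borel_measurable (f : O -> R) :
  continuous f -> measurable_fun [set: BO] (f : BO -> R).
Proof.
move=> /continuousP cf; apply: (measurability _ (RGenOpens.measurableE R)).
move=> _ [_ [a [b ->] <-]]; rewrite setTI; apply: sub_sigma_algebra.
exact/cf/interval_open.
Qed.

Lemma entry_bounded_measurable (i j : 'I_d) :
  bounded_measurable (fun g : BO => omx g i j).
Proof.
split; first by apply: continuous_borel_measurable; exact: entry_continuous.
by exists 1 => g; exact: orthogonal_entry_le1.
Qed.

(** In the initial topology continuity is tested on matrices, whose neighbourhoods come from the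
    entries; each entry of the product is linear in the entries of the variable matrix. *)
Lemma orthogonal_mul_continuous (h : O) : continuous (orthogonal_mul h : O -> O).
Proof.
apply: continuous_comp_initial => g A [P nP sPA].
apply: (@filterS _ _ _ (fun y => forall i j, P i j ((omx h *m omx y) i j))).
  by move=> y; exact: sPA.
have FF : Filter (nbhs g) := nbhs_filter g.
apply: (@filter_forall _ _ (fun i y => forall j, P i j ((omx h *m omx y) i j)) _ FF) => i.
apply: (@filter_forall _ _ (fun j y => P i j ((omx h *m omx y) i j)) _ FF) => j.
have := nP i j; rewrite /= mxE => nPij.
apply: (@filterS _ _ _ (fun y : O => P i j (\sum_k omx h i k * omx y k j))).
  by move=> y; rewrite mxE.
suff /(_ (P i j)) : (\sum_k omx h i k * omx y k j) @[y --> g] -->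
  \sum_k omx h i k * omx g k j by apply.
apply: cvg_big => [|k _]; first exact: add_continuous.
by apply: cvgMr; exact: entry_continuous.
Qed.

Lemma orthogonal_mul_measurable (h : O) :
  measurable_fun [set: BO] (orthogonal_mul h : BO -> BO).
Proof.
apply: (@measurability _ _ BO BO _ _ (@open O)) => //.
move=> _ [A oA <-]; rewrite setTI; apply: sub_sigma_algebra.
by move/continuousP: (@orthogonal_mul_continuous h); exact.
Qed.

Variables (mu : probability BO R) (hmu : is_haar mu).

(** The preimage of A under translation by h is the translate of A by the inverse of h, so [is_haar]
    identifies the pushforward of [mu] with [mu]. *)
Lemma haar_mean_left (h : O) (f : BO -> R) : bounded_measurable f ->
  mean mu (fun g => f (orthogonal_mul h g)) = mean mu f.
Proof.
move=> bf; have mh := orthogonal_mul_measurable h.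
have bfh : bounded_measurable (fun g : BO => f (orthogonal_mul h g)).
  case: bf => mf [M fM]; split; last by exists M => g.
  exact: (measurableT_comp mf mh).
rewrite /mean /Rintegral; congr fine.
have mf : measurable_fun [set: BO] (EFin \o f) by apply/measurable_EFinP; case: bf.
have := integral_pushforward mh mf (bounded_measurable_integrable mu bfh) measurableT.
rewrite preimage_setT => /esym Eint; apply: etrans Eint _.
apply: eq_measure_integral => A mA _; rewrite /pushforward.
rewrite -[RHS](hmu (orthogonal_inv h) mA); congr (mu _).
apply/seteqP; split => [g Ag|_ [g Ag <-]] /=; last by rewrite orthogonal_mulKV.
by exists (orthogonal_mul h g); rewrite ?orthogonal_mulK.
Qed.


End OrthogonalGroup.

(** * Moments of the entries of a Haar matrix *)

(** A nonzero difference would have as many distinct roots 0, 1, 2, ... as its size, one more than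
    its degree. *)
Lemma poly_eq_fun (R : numFieldType) (p q : {poly R}) :
  (forall t, p.[t] = q.[t]) -> p = q.
Proof.
move=> pq; apply/eqP; rewrite -subr_eq0; apply/eqP.
apply: (@roots_geq_poly_eq0 _ _ [seq (k%:R : R) | k <- iota 0 (size (p - q))]).
- by apply/allP => t _; rewrite rootE hornerD hornerN pq subrr.
- by rewrite map_inj_uniq ?iota_uniq // => a b /eqP; rewrite eqr_nat => /eqP.
by rewrite size_map size_iota.
Qed.

Section Moments.
Variables (R : realType) (d : nat).
Local Notation BO := (borel_orthogonal R d).
Variables (mu : probability BO R) (hmu : is_haar mu).
Local Notation E := (mean mu).
Local Notation bm := (@bounded_measurable _ BO R).

(* The matrix P of all mixed moments of degree N satisfies P = P^T P: average
   the left invariance of P under the transpose of h over all h. *)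
Lemma haar_moment_transpose (N : nat) (I J : {ffun 'I_N -> 'I_d}) :
  E (fun g => \prod_(k < N) omx g (I k) (J k)) =
  E (fun g => \prod_(k < N) omx g (J k) (I k)).
Proof.
pose P (I J : {ffun 'I_N -> 'I_d}) :=
  E (fun g => \prod_(k < N) omx g (I k) (J k)).
have bP (A B : {ffun 'I_N -> 'I_d}) : bm (fun g => \prod_(k < N) omx g (A k) (B k)).
  by apply: bounded_measurable_prod => k; exact: entry_bounded_measurable.
suff PE (A B : {ffun 'I_N -> 'I_d}) : P A B = \sum_(K : {ffun 'I_N -> 'I_d}) P K A * P K B.
  by rewrite -/(P I J) -/(P J I) !PE; apply: eq_bigr => K _; rewrite mulrC.
(* Each entry of the translated matrix is a sum over l; expanding the product of these sums indexes
   the terms by functions K. *)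
have inv (h : BO) : P A B =
    \sum_(K : {ffun 'I_N -> 'I_d}) P K B * (\prod_(k < N) omx h (K k) (A k)).
  rewrite {1}/P -(haar_mean_left hmu (orthogonal_inv h)) //.
  under eq_bigr do rewrite mulrC -meanZ //.
  rewrite -mean_sum => [|K]; last exact: bounded_measurableZ.
  congr (mean mu _); apply/funext => g.
  rewrite (eq_bigr (fun k => \sum_l omx h l (A k) * omx g l (B k))); last first.
    by move=> k _; rewrite /= mxE; apply: eq_bigr => l _; rewrite mxE.
  by rewrite bigA_distr_bigA /=; apply: eq_bigr => K _; rewrite big_split.
(* The left side does not depend on h, so it equals its mean over h. *)
rewrite -[LHS](mean_cst mu); under eq_fun => h do rewrite (inv h).
rewrite mean_sum => [|K]; last exact: bounded_measurableZ.
by apply: eq_bigr => K _; rewrite meanZ // mulrC.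
Qed.

Variable c : 'I_d.

Definition col_moment (s : seq 'I_d) : R := E (fun g => \prod_(k <- s) omx g k c).
Local Notation M := col_moment.

Lemma col_moment_perm s t : perm_eq s t -> M s = M t.
Proof. by move=> st; congr (mean mu _); apply/funext => g; apply: perm_big. Qed.

Lemma bounded_measurable_col s : bm (fun g => \prod_(k <- s) omx g k c).
Proof. by apply: bounded_measurable_prod => k; exact: entry_bounded_measurable. Qed.

Lemma col_moment_sphere s : \sum_i M [:: i, i & s] = M s.
Proof.
rewrite -mean_sum => [|i]; last exact: bounded_measurable_col.
congr (mean mu _); apply/funext => g.
rewrite [LHS](eq_bigr (fun i => omx g i c * omx g i c * \prod_(k <- s) omx g k c));
  last by move=> i _; rewrite !big_cons mulrA.
by rewrite -mulr_suml orthogonal_col_sum mul1r.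
Qed.

(** The Householder reflection in the hyperplane orthogonal to v. *)
Definition reflection (v : 'cV[R]_d) : 'M[R]_d :=
  1%:M - (2 / (v^T *m v) 0 0) *: (v *m v^T).

Lemma reflection_orthogonal v : (v^T *m v) 0 0 != 0 ->
  Defs.is_orthogonal (reflection v).
Proof.
move=> v0; rewrite /Defs.is_orthogonal /reflection.
rewrite raddfB /= [(_ *: _)^T]linearZ /= trmx1 trmx_mul trmxK.
set a := 2 / _; set W := v *m v^T.
have WW : W *m W = (v^T *m v) 0 0 *: W.
  rewrite /W mulmxA -(mulmxA v) (mx11_scalar (v^T *m v)) mul_mx_scalar.
  by rewrite -scalemxAl !mxE eqxx mulr1n.
rewrite mulmxBl mul1mx mulmxBr mulmx1 -scalemxAl -scalemxAr WW !scalerA.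
have -> : a * a * (v^T *m v) 0 0 = a + a by rewrite /a; field.
by rewrite scalerDl opprB addrK subrK.
Qed.

Lemma reflection_mulE v (A : 'M[R]_d) k : (reflection v *m A) k c =
  A k c - 2 / (\sum_l v l 0 * v l 0) * v k 0 * \sum_l v l 0 * A l c.
Proof.
rewrite mulmxBl mul1mx -scalemxAl -mulmxA !mxE big_ord1 !mxE !mulrA.
by congr (_ - 2 / _ * _ * _); apply: eq_bigr => l _; rewrite mxE.
Qed.

(** * Rotations of a coordinate plane and integration by parts *)

Section PlaneRotation.
Variables (i j : 'I_d).
Hypothesis neq_ij : i != j.
Let neq_ji : (j == i) = false. Proof. by rewrite eq_sym (negPf neq_ij). Qed.

(** Composing the reflections along this vector at t and at 0 gives a rotation whose entries are
    rational in t. Differentiation at t = 0 then amounts to reading off a coefficient. *)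
Definition plane_axis (t : R) : 'cV[R]_d :=
  \col_l ((l == i)%:R - t * (l == j)%:R).

Lemma plane_axis_dot (t : R) (y : 'I_d -> R) :
  \sum_l plane_axis t l 0 * y l = y i - t * y j.
Proof.
rewrite (bigD1 i) //= (bigD1 j) 1?eq_sym //= big1 => [|l /andP[li lj]].
  by rewrite !mxE !eqxx (negPf neq_ij) neq_ji /=; ring.
by rewrite !mxE (negPf li) (negPf lj) mulr0 subr0 mul0r.
Qed.

Lemma plane_axis_norm (t : R) :
  \sum_l plane_axis t l 0 * plane_axis t l 0 = 1 + t ^+ 2.
Proof.
rewrite plane_axis_dot !mxE !eqxx (negPf neq_ij) neq_ji /=; ring.
Qed.

Lemma plane_axis_norm_neq0 (t : R) : 1 + t ^+ 2 != 0.
Proof. by rewrite lt0r_neq0 // ltr_pwDl // sqr_ge0. Qed.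

Lemma plane_reflection_orthogonal (t : R) :
  Defs.is_orthogonal (reflection (plane_axis t)).
Proof.
apply: reflection_orthogonal; rewrite mxE.
rewrite (eq_bigr (fun l => plane_axis t l 0 * plane_axis t l 0)).
  by rewrite plane_axis_norm plane_axis_norm_neq0.
by move=> l _; rewrite mxE.
Qed.

(* Rotation in the plane of the coordinates i and j by the angle with
   tangent of the half-angle t. *)
Definition plane_rotation (t : R) : orthogonal_group R d :=
  orthogonal_mul (Orthogonal (plane_reflection_orthogonal t))
                 (Orthogonal (plane_reflection_orthogonal 0)).

Definition plane_generator (x : 'I_d -> R) (k : 'I_d) : R :=
  if k == i then x j else if k == j then - x i else 0.

(** Coordinate k of the rotated vector, as a polynomial in t after clearing the denominator 1 +
    t^2. *)
Definition rotation_poly (x : 'I_d -> R) (k : 'I_d) : {poly R} :=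
  (x k)%:P * (1 + (if (k == i) || (k == j) then -1 else 1)%:P * 'X^2) +
  (2 * plane_generator x k)%:P * 'X.

Lemma plane_rotationE (t : R) (g : orthogonal_group R d) (k : 'I_d) :
  (1 + t ^+ 2) * omx (orthogonal_mul (plane_rotation t) g) k c =
  (rotation_poly (fun l => omx g l c) k).[t].
Proof.
rewrite /plane_rotation /= -mulmxA !reflection_mulE !plane_axis_norm.
rewrite !plane_axis_dot !reflection_mulE !plane_axis_norm !plane_axis_dot.
rewrite /rotation_poly /plane_generator !hornerE !mxE !eqxx.
have t0 := plane_axis_norm_neq0 t.
rewrite neq_ji !mul0r !subr0 expr0n addr0 divr1.
have [->|ki] := eqVneq k i.
  by rewrite (negPf neq_ij) /=; field.
have [->|kj] := eqVneq k j; first by rewrite /=; field.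
by rewrite /=; field.
Qed.

Lemma rotation_poly_coef0 x k : (rotation_poly x k)`_0 = x k.
Proof.
by rewrite /rotation_poly coefD !coefCM coefD coefCM coefXn coef1 coefX /=; ring.
Qed.

Lemma rotation_poly_coef1 x k :
  (rotation_poly x k)`_1 = 2 * plane_generator x k.
Proof.
by rewrite /rotation_poly coefD !coefCM coefD coefCM coefXn coef1 coefX /=; ring.
Qed.

Lemma size_rotation_poly x k : (size (rotation_poly x k) <= 3)%N.
Proof.
apply/leq_sizeP => m m3; rewrite coefD !coefCM coefD coefCM coefXn coef1 coefX.
by case: m m3 => [|[|[|m]]] //= _; ring.
Qed.

Lemma size_rotation_poly_prod x s :
  (size (\prod_(k <- s) rotation_poly x k)%R <= (2 * size s).+1)%N.
Proof.
elim: s => [|k s IHs]; first by rewrite big_nil size_polyC oner_eq0.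
rewrite big_cons (leq_trans (size_polyMleq _ _)) //=.
rewrite -subn1 leq_subLR.
apply: leq_trans (leq_add (size_rotation_poly x k) IHs) _.
by rewrite mulnS.
Qed.

Lemma rotation_poly_prod_coef0 x s :
  (\prod_(k <- s) rotation_poly x k)`_0 = \prod_(k <- s) x k.
Proof.
elim: s => [|k s IHs]; first by rewrite !big_nil coef1.
by rewrite !big_cons coefM big_ord1 subnn /= IHs rotation_poly_coef0.
Qed.

(** The Leibniz rule: [count_mem l s] times the product over [rem l s] is the partial derivative of
    the monomial in the variable l. *)
Lemma rotation_poly_prod_coef1 x s :
  (\prod_(k <- s) rotation_poly x k)`_1 =
  2 * ((count_mem i s)%:R * (x j * \prod_(k <- rem i s) x k) -
       (count_mem j s)%:R * (x i * \prod_(k <- rem j s) x k)).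
Proof.
(* Removing l and multiplying back by x l changes nothing if l occurs; otherwise the multiplicity is
   0. *)
have remE l s' : (count_mem l s')%:R * \prod_(k <- s') x k =
    (count_mem l s')%:R * (x l * \prod_(k <- rem l s') x k).
  have [ls'|/count_memPn ->] := boolP (l \in s'); last by rewrite !mul0r.
  by congr (_ * _); rewrite (perm_big _ (perm_to_rem ls')) big_cons.
elim: s => [|k s IHs]; first by rewrite !big_nil coef1 /=; ring.
rewrite big_cons coefM big_ord_recl big_ord1 /= subn0 subnn.
rewrite rotation_poly_coef0 rotation_poly_coef1 rotation_poly_prod_coef0 IHs.
rewrite /plane_generator /=.
have [->|ki] := eqVneq k i.
  rewrite (negPf neq_ij) /= big_cons natrD.
  have := remE i s; set p := \prod_(k <- s) x k => Ei.
  transitivity (2 * (x j * p + x j * ((count_mem i s)%:R *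
     (x i * \prod_(k <- rem i s) x k)) - (count_mem j s)%:R *
     (x i * (x i * \prod_(k <- rem j s) x k)))); first by ring.
  by rewrite -Ei; ring.
have [->|kj] := eqVneq k j.
  rewrite /= big_cons natrD.
  have := remE j s; set p := \prod_(k <- s) x k => Ej.
  transitivity (2 * ((count_mem i s)%:R * (x j * (x j * \prod_(k <- rem i s) x k))
     - x i * p - x i * ((count_mem j s)%:R *
     (x j * \prod_(k <- rem j s) x k)))); first by ring.
  by rewrite -Ej; ring.
by rewrite /= !big_cons !natrD; ring.
Qed.

Lemma bounded_measurable_rotation_coef s m :
  bm (fun g => (\prod_(k <- s) rotation_poly (fun l => omx g l c) k)`_m).
Proof.
have bq k p : bm (fun g => (rotation_poly (fun l => omx g l c) k)`_p).
  rewrite /rotation_poly; under eq_fun do rewrite coefD !coefCM.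
  apply: bounded_measurableD.
    apply: bounded_measurableM; first exact: entry_bounded_measurable.
    exact: bounded_measurable_cst.
  apply: bounded_measurableM; last exact: bounded_measurable_cst.
  apply: bounded_measurableZ; rewrite /plane_generator.
  case: eqP => _; first exact: entry_bounded_measurable.
  case: eqP => _; last exact: bounded_measurable_cst.
  under eq_fun do rewrite -mulN1r.
  by apply: bounded_measurableZ; exact: entry_bounded_measurable.
elim: s m => [|k s IHs] m.
  by under eq_fun do rewrite big_nil; exact: bounded_measurable_cst.
under eq_fun do rewrite big_cons coefM.
by apply: bounded_measurable_sum => p; exact: bounded_measurableM.
Qed.

Lemma one_plus_X2_coef1 (m : nat) : ((1 + 'X^2 : {poly R}) ^+ m)`_1 = 0.
Proof.
elim: m => [|m IHm]; first by rewrite expr0 coef1.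
rewrite exprS coefM big_ord_recl big_ord1 /= subn0 IHm.
by rewrite !coefD !coef1 !coefXn /=; ring.
Qed.

(** Invariance under [plane_rotation t], where each of the [size s] factors brings one denominator 1
    + t^2. *)
Lemma mean_rotation_poly_horner s t :
  E (fun g => (\prod_(k <- s) rotation_poly (fun l => omx g l c) k).[t]) =
  (1 + t ^+ 2) ^+ size s * M s.
Proof.
rewrite -[M s](haar_mean_left hmu (plane_rotation t) (bounded_measurable_col s)).
rewrite -meanZ; last first.
  have [mf [B fB]] := bounded_measurable_col s; split; last by exists B => g.
  exact: (measurableT_comp mf (orthogonal_mul_measurable _)).
congr (mean mu _); apply/funext => g; rewrite horner_prod.
elim: s => [|k s IHs]; first by rewrite !big_nil mulr1.
rewrite !big_cons IHs -plane_rotationE -[size (k :: s)]/(size s).+1.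
by rewrite [_ ^+ (size s).+1]exprS; ring.
Qed.

(* First-order coefficient in t of the invariance under [plane_rotation t]:
   integration by parts for the vector field x_j d/dx_i - x_i d/dx_j. *)
Lemma col_moment_rotation s :
  (count_mem i s)%:R * M (j :: rem i s) = (count_mem j s)%:R * M (i :: rem j s).
Proof.
pose P (g : BO) := \prod_(k <- s) rotation_poly (fun l => omx g l c) k.
pose N := (2 * size s).+1.
have bP m : bm (fun g => (P g)`_m) by exact: bounded_measurable_rotation_coef.
(* Both sides agree at every t, so they agree as polynomials; the right side is even in t and has no
   linear coefficient. *)
have EP : \poly_(m < N) E (fun g => (P g)`_m) =
    (M s)%:P * (1 + 'X^2) ^+ size s.
  apply: poly_eq_fun => t; rewrite [RHS]hornerM horner_exp !hornerE.
  rewrite mulrC -mean_rotation_poly_horner horner_poly.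
  transitivity (E (fun g => \sum_(m < N) t ^+ m * (P g)`_m)).
    rewrite mean_sum => [|m]; last exact: bounded_measurableZ.
    by apply: eq_bigr => m _; rewrite meanZ // mulrC.
  congr (mean mu _); apply/funext => g.
  rewrite (horner_coef_wide _ (size_rotation_poly_prod _ _)).
  by apply: eq_bigr => m _; rewrite mulrC.
have /(congr1 (fun p : {poly R} => p`_1)) := EP.
rewrite coef_poly coefCM one_plus_X2_coef1 mulr0.
(* The bound N exceeds 1 unless s is empty, in which case both multiplicities are 0. *)
case: ltnP => [_|]; last first.
  rewrite /N ltnS leqn0 muln_eq0 /= size_eq0 => /eqP -> _.
  by rewrite /= !mul0r.
under [X in mean mu X]eq_fun do rewrite /P rotation_poly_prod_coef1.
have bK k l : bm (fun g : BO => omx g k c * \prod_(n <- l) omx g n c).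
  by apply: bounded_measurableM; [exact: entry_bounded_measurable|exact: bounded_measurable_col].
rewrite meanZ; last first.
  apply: bounded_measurableD; first exact: bounded_measurableZ.
  under eq_fun do rewrite -mulNr; exact: bounded_measurableZ.
under [X in mean mu X]eq_fun do rewrite -mulNr.
rewrite meanD; [|exact: bounded_measurableZ|exact: bounded_measurableZ].
rewrite !meanZ // => /eqP; rewrite mulf_eq0 pnatr_eq0 /= mulNr subr_eq0 => /eqP.
have ME k l : M (k :: l) = E (fun g => omx g k c * \prod_(m <- l) omx g m c).
  by congr (mean mu _); apply/funext => g; rewrite big_cons.
by rewrite !ME.
Qed.

End PlaneRotation.

(** * Recurrence and closed form for the moments of a column *)

Lemma sum_count_mem (s : seq 'I_d) : (\sum_i count_mem i s = size s)%N.
Proof.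
elim: s => [|k s IHs]; first by rewrite big1.
rewrite big_split /= IHs (bigD1 k) //= eqxx big1 // => i.
by rewrite eq_sym => /negPf ->.
Qed.

(** Sum [col_moment_rotation] for [i :: s] over all i other than j. The sphere relation evaluates
    the right side up to the term i = j, which moves to the left and completes the factor there. *)
Lemma col_moment_rec (j : 'I_d) (s : seq 'I_d) :
  (d%:R - 1 + (size s)%:R) * M (j :: s) = (count_mem j s)%:R * M (rem j s).
Proof.
have rotE i : i != j -> (1 + (count_mem i s)%:R) * M (j :: s) =
    (count_mem j s)%:R * M [:: i, i & rem j s].
  move=> ij; have := col_moment_rotation ij (i :: s).
  by rewrite /= !eqxx (negPf ij) natrD add0n.
have : \sum_(i | i != j) (1 + (count_mem i s)%:R) * M (j :: s) =
    \sum_(i | i != j) (count_mem j s)%:R * M [:: i, i & rem j s].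
  exact: eq_bigr.
rewrite -mulr_suml -mulr_sumr.
have -> : \sum_(i | i != j) M [:: i, i & rem j s] =
    M (rem j s) - M [:: j, j & rem j s].
  by rewrite -(col_moment_sphere (rem j s)) [X in X - _](bigD1 j) //= [RHS]addrC addKr.
have -> : \sum_(i | i != j) (1 + (count_mem i s)%:R) =
    d%:R - 1 + (size s)%:R - (count_mem j s)%:R :> R.
  rewrite -(sum_count_mem s) natr_sum [in RHS](bigD1 j) //= big_split /= sumr_const.
  rewrite cardC1 card_ord -subn1 natrB; last by rewrite (leq_ltn_trans _ (ltn_ord j)).
  by ring.
have -> : (count_mem j s)%:R * (M (rem j s) - M [:: j, j & rem j s]) =
    (count_mem j s)%:R * (M (rem j s) - M (j :: s)).
  (* If j occurs in s, then [[:: j, j & rem j s]] is a rearrangement of [j :: s]; otherwise the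
     factor is 0. *)
  have [js|/count_memPn ->] := boolP (j \in s); last by rewrite !mul0r.
  congr (_ * (_ - _)); apply: col_moment_perm.
  by rewrite perm_cons perm_sym perm_to_rem.
rewrite mulrBl mulrBr.
move=> /(congr1 (+%R^~ ((count_mem j s)%:R * M (j :: s)))).
by rewrite !subrK.
Qed.

Lemma double_fact_odd m : odd m -> double_fact m = (m * double_fact m.-2)%N.
Proof. by case: m => [|[|m]]. Qed.

(** Induction removing two copies of the head j. Its remaining multiplicity in the tail is odd and
    supplies the leading factor of the double factorial. *)
Lemma col_moment_even (n : nat) (s : seq 'I_d) :
  size s = n.*2 -> (forall x, ~~ odd (count_mem x s)) ->
  M s * \prod_(k < n) (d%:R + 2 * k%:R) =
  \prod_x (double_fact (count_mem x s).-1)%:R.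
Proof.
elim: n s => [|n IHn] [|j s] //= sz_s evs.
  rewrite big_ord0 mulr1 big1 //.
  by rewrite -(mean_cst mu 1); congr (mean mu _); apply/funext => g; rewrite big_nil.
have odd_c : odd (count_mem j s) by have := evs j; rewrite eqxx /= negbK.
have js : j \in s by rewrite -has_pred1 has_count; case: count odd_c.
have ev_rem x : ~~ odd (count_mem x (rem j s)).
  rewrite count_rem js /=; have := evs x; have [<-|xj] := eqVneq j x.
    by rewrite /= negbK subn1; case: count => //= m; rewrite negbK.
  by rewrite subn0 add0n.
have sz_rem : size (rem j s) = n.*2.
  by rewrite size_rem //; case: sz_s => ->.
have recE := col_moment_rec j s.
(* Here [s] is the tail, of size 2n + 1. *)
have dE : d%:R - 1 + (size s)%:R = d%:R + 2 * n%:R :> R.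
  by case: sz_s => ->; rewrite -natr1 -muln2 natrM; ring.
rewrite big_ord_recr /=.
transitivity ((count_mem j s)%:R *
    (M (rem j s) * \prod_(k < n) (d%:R + 2 * k%:R))).
  by rewrite [RHS]mulrA -recE dE; ring.
rewrite IHn //.
rewrite (bigD1 j) //= [RHS](bigD1 j) //= mulrA; congr (_ * _).
  rewrite eqxx /= -natrM; congr (_%:R); rewrite (double_fact_odd odd_c).
  by rewrite count_rem js /= eqxx subn1.
by apply: eq_bigr => x xj; rewrite count_rem js /= eq_sym (negPf xj) subn0.
Qed.

End Moments.

(** Values that do not occur contribute [double_fact 0 = 1], as [0.-1] is 0. *)
Lemma prod_mult_partition (R : comNzRingType) (d : nat) (s : seq 'I_d) :
  \prod_(m <- mult_partition s) (double_fact m.-1)%:R =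
  \prod_x (double_fact (count_mem x s).-1)%:R :> R.
Proof.
rewrite (perm_big _ (permEl (perm_sort _ _))) big_map.
rewrite (big_uniq _ (undup_uniq s)) /= big_mkcond; apply: eq_bigr => x _.
by case: ifP => //; rewrite mem_undup => /negbT/count_memPn ->.
Qed.

Lemma mult_partition_even (d : nat) (s : seq 'I_d) :
  all (fun m => ~~ odd m) (mult_partition s) ->
  forall x, ~~ odd (count_mem x s).
Proof.
rewrite /mult_partition all_sort all_map => /allP ev x.
have [xs|/count_memPn -> //] := boolP (x \in s).
by apply: ev; rewrite mem_undup.
Qed.

Unset Implicit Arguments.

Theorem theorem5p3 (R : realType) (d n : nat) (hd : (0 < d)%N) (hn : (0 < n)%N)
    (J : (n.*2).-tuple 'I_d)
    (hJ : all (fun m : nat => ~~ odd m) (mult_partition J))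
    (mu : probability (borel_orthogonal R d) R) (hmu : is_haar mu) :
  (\int[mu]_(g in [set: borel_orthogonal R d]%classic)
     (\prod_(i < n.*2) omx g (Ordinal hd) (tnth J i))%:E)%E =
  ((\prod_(m <- mult_partition J) (double_fact m.-1)%:R) *
   \sum_(la : intpart n)
     (num_coset_type la)%:R * weingarten_part R d la)%:E.
Proof.
set c := Ordinal hd.
rewrite (@meanE _ _ _ mu (fun g => \prod_(i < n.*2) omx g c (tnth J i))); last first.
  by apply: bounded_measurable_prod => i; exact: entry_bounded_measurable.
congr (_%:E)%E.
(* With a constant row index, transposition replaces the first row by the first column, making the
   integral a [col_moment]. *)
have := haar_moment_transpose hmu [ffun=> c] [ffun i => tnth J i].
under eq_fun do under eq_bigr do rewrite !ffunE.
move=> ->; under eq_fun do under eq_bigr do rewrite !ffunE.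
under eq_fun => g do rewrite -(big_tuple _ _ J xpredT (fun k => omx g k c)).
(* The right side becomes the sum over all permutations divided by the order of the hyperoctahedral
   group, which cancels in the next line. *)
rewrite (sum_coset_type (@weingarten_partE R d n)) sum_weingarten //.
rewrite mulKf; last by rewrite pnatr_eq0 -lt0n cardG_gt0.
rewrite prod_mult_partition.
rewrite -(col_moment_even hmu c (size_tuple J) (mult_partition_even hJ)).
by rewrite mulfK ?prod_shift_neq0.
Qed.
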